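(* $$\frac{1}{1-t}+\sum_{n=1}^\infty\frac{(1+yt)^n}{(1-t)^{n+1}}I_n^{(\mathrm{lpk},\mathrm{des},\mathrm{fix})}\left(\frac{(1+y)^2t}{(y+t)(1+yt)},\frac{y+t}{1+yt},z\right)x^n=\sum_{k=0}^\infty\frac{(1+zxy)^k(1+x^2y)^{k^2+k}t^k}{(1-zx)^{k+1}(1-x^2)^{\binom{k+1}2}(1-x^2y^2)^{\binom{k+1}2}}.$$
   Context: For a permutation $\pi=\pi(1)\cdots\pi(n)$ of $[n]=\{1,\dots,n\}$, $\mathrm{des}(\pi)$ is the number of descents, i.e. $i\in[n-1]$ with $\pi(i)>\pi(i+1)$; an index $i\in[n-1]$ is a left peak if either $2\le i\le n-1$ and $\pi(i-1)<\pi(i)>\pi(i+1)$, or $i=1$ and $\pi(1)>\pi(2)$, and $\mathrm{lpk}(\pi)$ is the number of left peaks; $\mathrm{fix}(\pi)$ is the number of fixed points. $\mathfrak{I}_n$ is the set of involutions of $[n]$ (permutations $\pi$ with $\pi^2$ the identity), and $$I_n^{(\mathrm{lpk},\mathrm{des},\mathrm{fix})}(y,t,z)=\sum_{\pi\in\mathfrak{I}_n}y^{\mathrm{lpk}(\pi)}t^{\mathrm{des}(\pi)}z^{\mathrm{fix}(\pi)}.$$ The identity is between formal power series in $x$ and $t$; rational functions of $y,t$ are expanded as power series in $t$. *)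

(* Defs.v *)
From HB Require Import structures.
From mathcomp Require Import all_boot all_fingroup all_algebra.
From mathcomp Require Import boolp.

Set Implicit Arguments.
Unset Strict Implicit.
Unset Printing Implicit Defensive.

Import GRing.Theory.

Local Open Scope ring_scope.

(* Formal power series: [fpscoef f n] is the coefficient of the n-th power of
   the variable. *)
Record fps (R : Type) := FPS { fpscoef : nat -> R }.

Notation "{ 'fps' R }" := (fps R) (format "{ 'fps'  R }") : type_scope.

Lemma fpsP (R : Type) (f g : {fps R}) :
  (forall n, fpscoef f n = fpscoef g n) -> f = g.
Proof. by case: f g => [f] [g] /= /funext ->. Qed.

HB.instance Definition _ (R : Type) := gen_eqMixin {fps R}.
HB.instance Definition _ (R : Type) := gen_choiceMixin {fps R}.

Section FpsZmod.
Variable R : zmodType.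
Implicit Types f g h : {fps R}.

Definition fps_zero : {fps R} := FPS (fun=> 0).
Definition fps_opp f : {fps R} := FPS (fun n => - fpscoef f n).
Definition fps_add f g : {fps R} := FPS (fun n => fpscoef f n + fpscoef g n).

Fact fps_addA : associative fps_add.
Proof. by move=> f g h; apply: fpsP => n /=; rewrite addrA. Qed.
Fact fps_addC : commutative fps_add.
Proof. by move=> f g; apply: fpsP => n /=; rewrite addrC. Qed.
Fact fps_add0 : left_id fps_zero fps_add.
Proof. by move=> f; apply: fpsP => n /=; rewrite add0r. Qed.
Fact fps_addN : left_inverse fps_zero fps_opp fps_add.
Proof. by move=> f; apply: fpsP => n /=; rewrite addNr. Qed.

HB.instance Definition _ := GRing.isZmodule.Build {fps R}
  fps_addA fps_addC fps_add0 fps_addN.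

Lemma fpscoef0 n : fpscoef (0 : {fps R}) n = 0. Proof. by []. Qed.
Lemma fpscoefN f n : fpscoef (- f) n = - fpscoef f n. Proof. by []. Qed.
Lemma fpscoefD f g n : fpscoef (f + g) n = fpscoef f n + fpscoef g n.
Proof. by []. Qed.

End FpsZmod.

Section FpsRing.
Variable R : comNzRingType.
Implicit Types f g h : {fps R}.

Definition fps_const (c : R) : {fps R} := FPS (fun n => c *+ (n == 0%N)).
Definition fps_var : {fps R} := FPS (fun n => (n == 1%N)%:R).
Definition fps_mul f g : {fps R} :=
  FPS (fun n => \sum_(i < n.+1) fpscoef f i * fpscoef g (n - i)).

Definition fps_trunc m f : {poly R} := \poly_(i < m) fpscoef f i.

Lemma fps_mulE m f g n : (n < m)%N ->
  fpscoef (fps_mul f g) n = (fps_trunc m f * fps_trunc m g)`_n.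
Proof.
move=> lt_nm; rewrite coefM; apply: eq_bigr => i _.
by rewrite !coef_poly !ifT // (leq_ltn_trans _ lt_nm) ?leq_subr // -ltnS.
Qed.

Fact fps_mulA : associative fps_mul.
Proof.
move=> f g h; apply: fpsP => n.
transitivity ((fps_trunc n.+1 f * (fps_trunc n.+1 g * fps_trunc n.+1 h))`_n).
  rewrite /= coefM; apply: eq_bigr => i _.
  rewrite coef_poly ltn_ord; congr (_ * _).
  by apply: fps_mulE; rewrite ltnS leq_subr.
rewrite mulrA /= coefM; apply: eq_bigr => i _.
rewrite coef_poly ifT ?ltnS ?leq_subr //; congr (_ * _).
by rewrite -fps_mulE.
Qed.

Fact fps_mulC : commutative fps_mul.
Proof.
by move=> f g; apply: fpsP => n; rewrite !(@fps_mulE n.+1) // mulrC.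
Qed.

Fact fps_mul1 : left_id (fps_const 1) fps_mul.
Proof.
move=> f; apply: fpsP => n /=.
by rewrite big_ord_recl big1 /= ?mul1r ?subn0 ?addr0 // => i _; rewrite mul0r.
Qed.

Fact fps_mulDl : left_distributive fps_mul (@fps_add R).
Proof.
move=> f g h; apply: fpsP => n /=; rewrite -big_split.
by apply: eq_bigr => i _; rewrite mulrDl.
Qed.

Fact fps_1_neq0 : fps_const 1 != 0.
Proof. by apply/eqP => /(congr1 (fun f => fpscoef f 0))/eqP; rewrite /= oner_eq0. Qed.

HB.instance Definition _ := GRing.Zmodule_isComNzRing.Build {fps R}
  fps_mulA fps_mulC fps_mul1 fps_mulDl fps_1_neq0.

Lemma fpscoef1 n : fpscoef (1 : {fps R}) n = (n == 0%N)%:R. Proof. by []. Qed.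
Lemma fpscoefM f g n :
  fpscoef (f * g) n = \sum_(i < n.+1) fpscoef f i * fpscoef g (n - i).
Proof. by []. Qed.

End FpsRing.

Arguments fps_var {R}.

Section FpsUnitRing.
Variable R : comUnitRingType.
Implicit Types f g h : {fps R}.

Definition fps_unit : pred {fps R} := fun f => fpscoef f 0 \is a GRing.unit.

(* The first n coefficients of the inverse of f, highest index first. *)
Fixpoint fps_inv_seq f n : seq R :=
  if n is m.+1 then
    let s := fps_inv_seq f m in
    (fpscoef f 0)^-1 * ((m == 0%N)%:R - \sum_(i < m) fpscoef f i.+1 * s`_i) :: s
  else [::].

(* As usual in MathComp, the inverse of a non-unit is itself. *)
Definition fps_inv f : {fps R} :=
  if fps_unit f then FPS (fun n => (fps_inv_seq f n.+1)`_0) else f.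

Lemma fps_inv_seqE f n i : (i < n)%N ->
  (fps_inv_seq f n)`_i = (fps_inv_seq f (n - i))`_0.
Proof. by elim: n i => // n IHn [|i] //= /IHn; rewrite subSS. Qed.

Fact fps_mulVr : {in fps_unit, left_inverse 1 fps_inv *%R}.
Proof.
move=> f Uf; rewrite mulrC; apply: fpsP => n.
rewrite fpscoefM big_ord_recl subn0 /fps_inv ifT // [in X in X + _]/=.
rewrite mulrA divrr // mul1r -[RHS]addr0 -addrA; congr (_ + _); apply/eqP.
rewrite addrC subr_eq0; apply/eqP/eq_bigr => i _; rewrite lift0.
rewrite fps_inv_seqE ?ltn_ord //.
by have -> : (n - i = (n - i.+1).+1)%N by rewrite subnSK ?ltn_ord.
Qed.

Fact fps_unitP f g : g * f = 1 -> fps_unit f.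
Proof.
move=> /(congr1 (fun f => fpscoef f 0)); rewrite /= big_ord1 => gf1.
by apply/unitrPr; exists (fpscoef g 0); rewrite mulrC.
Qed.

Fact fps_inv_out : {in [predC fps_unit], fps_inv =1 id}.
Proof. by move=> f /negbTE nUf; rewrite /fps_inv [fps_unit f]nUf. Qed.

HB.instance Definition _ := GRing.ComNzRing_hasMulInverse.Build {fps R}
  fps_mulVr fps_unitP fps_inv_out.

Lemma fps_unitE f : (f \is a GRing.unit) = (fpscoef f 0 \is a GRing.unit).
Proof. by []. Qed.

End FpsUnitRing.

(* Power series in x and t: {fps {fps R}}, the outer variable being x and the
   inner one t. *)
Definition xtcoef (R : Type) (f : {fps {fps R}}) (i j : nat) : R :=
  fpscoef (fpscoef f i) j.

(* S is the sum of the F k, k >= 0, as a formal power series in x and t: for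
   every i and j, the coefficient of x^i t^j in the partial sums is eventually
   constant, equal to the one in S. *)
Definition fps_sum_to (R : comNzRingType) (F : nat -> {fps {fps R}})
    (S : {fps {fps R}}) : Prop :=
  forall i j, exists N, forall M, (N <= M)%N ->
    xtcoef (\sum_(k < M) F k) i j = xtcoef S i j.

Lemma fps_sum_to_uniq (R : comNzRingType) (F : nat -> {fps {fps R}}) S1 S2 :
  fps_sum_to F S1 -> fps_sum_to F S2 -> S1 = S2.
Proof.
move=> F1 F2; apply: fpsP => i; apply: fpsP => j.
have [[N1 E1] [N2 E2]] := (F1 i j, F2 i j).
by rewrite -[LHS](E1 _ (leq_maxl N1 N2)) -[RHS](E2 _ (leq_maxr N1 N2)).
Qed.

(* Coefficients: the field Q(y, z), with z the outer polynomial variable. *)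
Notation Qyz := {fraction {poly {poly rat}}}.

Definition yvar : {fps {fps Qyz}} :=
  fps_const (fps_const (FracField.tofrac 'X%:P)).
Definition zvar : {fps {fps Qyz}} :=
  fps_const (fps_const (FracField.tofrac 'X)).
Definition tvar : {fps {fps Qyz}} := fps_const fps_var.
Definition xvar : {fps {fps Qyz}} := fps_var.

Section Statistics.
Variable n : nat.
Implicit Types (s : 'S_n) (i : 'I_n).

(* Positions and values are numbered from 0 to n - 1. The existence of the
   successor j of i in 'I_n excludes the last position. *)
Definition is_descent s i : bool :=
  [exists j : 'I_n, (j == i.+1 :> nat) && (s j < s i)%N].

Definition is_left_peak s i : bool :=
  ((i == 0%N :> nat) ||
     [exists h : 'I_n, (i == h.+1 :> nat) && (s h < s i)%N])
  && is_descent s i.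

Definition des s : nat := #|[set i | is_descent s i]|.
Definition lpk s : nat := #|[set i | is_left_peak s i]|.
Definition fix_pts s : nat := #|[set i | s i == i]|.

Definition involutions : {set 'S_n} := [set s | (s ^+ 2)%g == 1%g].

End Statistics.

Definition I_lpk_des_fix (R : comNzRingType) (n : nat) (y t z : R) : R :=
  \sum_(s in involutions n) y ^+ lpk s * t ^+ des s * z ^+ fix_pts s.

(* Main.v *)
From HB Require Import structures.
Require Import Defs.
From mathcomp Require Import all_boot all_fingroup all_algebra.
From mathcomp Require Import ring zify.

Set Implicit Arguments.
Unset Strict Implicit.
Unset Printing Implicit Defensive.

Import GRing.Theory.
Local Open Scope ring_scope.

(** Both sides count the same objects. Fix k and the alphabet of letters
    0, 1, ..., 2k, in which the letter 2j is plain and the letter 2j - 1 is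
    barred. A word b of length n in these letters is compatible with a
    permutation s when it is weakly increasing and repeats a plain letter only
    across ascents of s, a barred one only across descents; it has weight
    y ^ (number of barred letters).

    Permutation side ([fpscoef_chain_series]). For a fixed s, the series in t
    whose k-th coefficient is the weighted number of words compatible with s is
      (1 + yt)^n / (1-t)^(n+1) * u^(lpk s) * v^(des s),
    u and v being the two arguments of the polynomial I_n in the theorem. Words
    are built letter by letter; two series record the sums over the words whose
    last letter is at most 2j and at most 2j - 1. Appending a letter across an
    ascent or a descent acts on this pair of series by a matrix of rank one, so
    that the factor gained at a step depends only on this step and on the
    previous one: this is why exactly des and lpk appear ([even_series_eq]).

    Product side ([sum_labelled_wt_series], [prod_block_series]). Let (s, b) be
    an involution with a compatible word, and A i j the number of positions m
    with b m = i and b (s m) = j; the matrix A is symmetric. The positions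
    carrying the letter i form an interval, on which s is increasing if i is
    plain and decreasing if i is barred. This has three consequences. The pair
    (s, b) can be recovered from A. If i and j have different types then
    A i j <= 1, as s must be increasing one way and decreasing the other. On the
    A i i positions that s exchanges within the letter i, s is the identity if i
    is plain and the reversal if i is barred, so it has A i i fixed points or
    (A i i mod 2) of them. Conversely all symmetric matrices with these bounds
    occur. Hence the weighted count of the pairs (s, b) is the coefficient of
    x^n in a product over i <= j of
      1 / (1 - zx)                    for i = j plain,
      (1 + zxy) / (1 - x^2 y^2)       for i = j barred,
      1 / (1 - x^2), 1 / (1 - x^2 y^2), 1 + x^2 y
                                      for i < j both plain, both barred, mixed,
    and with k + 1 plain and k barred letters this product is the k-th term of
    the right-hand side.

    The bijection is set up through the cells (i, j, c), c < A i j, of the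
    matrix: ordering them suitably and numbering them gives the positions, and
    transposing them gives the involution ([models]). *)

(** * Formal power series *)

Section SeriesMorphisms.
Variable R : comNzRingType.

Fact fps_const_zmod : zmod_morphism (@fps_const R).
Proof. by move=> a b; apply: fpsP => n; rewrite /= mulrnBl. Qed.

Fact fps_const_monoid : monoid_morphism (@fps_const R).
Proof.
split=> [|a b]; apply: fpsP => n //.
rewrite fpscoefM big_ord_recl big1 => [|i _] /=; last by rewrite mul0r.
by rewrite mulr1n subn0 addr0 mulrnAr.
Qed.

HB.instance Definition _ :=
  GRing.isZmodMorphism.Build R {fps R} (@fps_const R) fps_const_zmod.
HB.instance Definition _ :=
  GRing.isMonoidMorphism.Build R {fps R} (@fps_const R) fps_const_monoid.

Lemma fpscoefB (f g : {fps R}) n : fpscoef (f - g) n = fpscoef f n - fpscoef g n.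
Proof. by []. Qed.

Lemma fpscoef_sum (I : Type) (r : seq I) (P : pred I) (F : I -> {fps R}) n :
  fpscoef (\sum_(i <- r | P i) F i) n = \sum_(i <- r | P i) fpscoef (F i) n.
Proof. exact: (big_morph (fun f => fpscoef f n)). Qed.

Lemma fpscoef_constM c (f : {fps R}) n :
  fpscoef (fps_const c * f) n = c * fpscoef f n.
Proof.
rewrite fpscoefM big_ord_recl big1 => [|i _] /=; last by rewrite mul0r.
by rewrite mulr1n subn0 addr0.
Qed.

Lemma fpscoef_varM (f : {fps R}) n :
  fpscoef (fps_var * f) n = if n is m.+1 then fpscoef f m else 0.
Proof.
case: n => [|n]; first by rewrite fpscoefM big_ord1 mul0r.
rewrite fpscoefM 2!big_ord_recl big1 => [|i _] /=; last by rewrite mul0r.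
by rewrite mul0r mul1r add0r addr0 subSS subn0.
Qed.

Lemma fpscoef_MvarXn (f : {fps R}) m n :
  fpscoef (f * fps_var ^+ m) n = if (m <= n)%N then fpscoef f (n - m) else 0.
Proof.
elim: m n => [|m IHm] n; first by rewrite expr0 mulr1 subn0.
by rewrite exprS mulrCA fpscoef_varM; case: n => [|n].
Qed.

(** The coefficient of degree n only depends on the truncations of the factors,
    and a product of polynomials is expanded by distributivity. *)
Lemma fpscoef_prod (E : finType) (f : E -> {fps R}) n :
  fpscoef (\prod_e f e) n =
  \sum_(a : {ffun E -> 'I_n.+1} | (\sum_e a e)%N == n) \prod_e fpscoef (f e) (a e).
Proof.
have truncP m (s : seq E) : (m <= n)%N ->
    fpscoef (\prod_(e <- s) f e) m = (\prod_(e <- s) fps_trunc n.+1 (f e))`_m.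
  elim: s m => [|e s IHs] m le_mn; first by rewrite !big_nil coef1.
  rewrite !big_cons coefM fpscoefM; apply: eq_bigr => i _.
  rewrite IHs ?(leq_trans (leq_subr _ _)) // coef_poly ifT //.
  by rewrite (leq_ltn_trans (leq_ord i)).
rewrite truncP //; under eq_bigr do rewrite /fps_trunc poly_def.
rewrite bigA_distr_bigA /= coef_sum [RHS]big_mkcond; apply: eq_bigr => a _.
rewrite (eq_bigr (fun e => (fpscoef (f e) (a e))%:P * 'X^(a e))); last first.
  by move=> e _; rewrite mul_polyC.
rewrite big_split /= -rmorph_prod /= -(big_morph _ (exprD 'X) (expr0 'X)).
by rewrite mul_polyC coefZ coefXn eq_sym; case: eqP; rewrite ?mulr1 ?mulr0.
Qed.

End SeriesMorphisms.

(** All the series in x needed below are geometric with ratio c x^2, up to a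
    numerator of degree at most 1. *)
Lemma fps_inv_step2 (R : comUnitRingType) (c d : R) :
  (1 + fps_const d * fps_var) / (1 - fps_const c * fps_var ^+ 2) =
  FPS (fun n => c ^+ n./2 * (if odd n then d else 1)).
Proof.
set g := FPS _.
have Ug: (1 - fps_const c * fps_var ^+ 2) \is a GRing.unit.
  by rewrite fps_unitE fpscoefB fpscoef_constM fpscoef_varM mulr0 subr0 unitr1.
apply: (mulIr Ug); rewrite divrK // mulrBr mulr1; apply: fpsP => n.
rewrite fpscoefB [g * _]mulrC -mulrA [fps_var ^+ 2 * g]mulrC fpscoef_constM.
rewrite fpscoef_MvarXn fpscoefD fpscoef_constM.
case: n => [|[|n]] /=; rewrite ?mulr0 ?addr0 ?subr0 ?mulr1 ?mul1r ?add0r //.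
by rewrite subn2 /= negbK mulrA -exprS subrr.
Qed.

(** * Chains of letters *)

Section Chains.
Variables (R : comNzRingType) (y : R).
Implicit Types (D : nat -> bool) (j m n : nat).

(** Letters are natural numbers, the odd ones being barred. *)
Definition letter_wt (l : nat) : R := if odd l then y else 1.

(** [d] tells whether a descent separates the two positions. *)
Definition letter_step (d : bool) (l l' : nat) : bool :=
  (l < l')%N || (l == l') && (odd l == d).

Definition chain D n M (b : {ffun 'I_n -> 'I_M}) : bool :=
  [forall i : 'I_n, forall j : 'I_n,
     (j == i.+1 :> nat) ==> letter_step (D i) (b i) (b j)].

(** Total weight of the words of length n + 1 that end with the letter l; see
    [sum_chain_last]. *)
Fixpoint end_wt D n (l : nat) : R :=
  letter_wt l *
  (if n is m.+1 then \sum_(l' < l.+1 | letter_step (D m) l' l) end_wt D m l'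
   else 1).

Definition ffun_snoc n (T : finType) (b : {ffun 'I_n -> T}) (l : T) :
    {ffun 'I_n.+1 -> T} :=
  [ffun i => if unlift ord_max i is Some j then b j else l].

Lemma ffun_snoc_lift n (T : finType) (b : {ffun 'I_n -> T}) (l : T) i :
  ffun_snoc b l (lift ord_max i) = b i.
Proof. by rewrite ffunE liftK. Qed.

Lemma ffun_snoc_max n (T : finType) (b : {ffun 'I_n -> T}) (l : T) :
  ffun_snoc b l ord_max = l.
Proof. by rewrite ffunE unlift_none. Qed.

Lemma big_ffun_snoc n (T : finType) (P : pred {ffun 'I_n.+1 -> T})
    (F : {ffun 'I_n.+1 -> T} -> R) :
  \sum_(b | P b) F b =
  \sum_(l : T) \sum_(b : {ffun 'I_n -> T} | P (ffun_snoc b l)) F (ffun_snoc b l).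
Proof.
rewrite pair_big_dep /=.
rewrite (reindex (fun p : T * {ffun 'I_n -> T} => ffun_snoc p.2 p.1)) //=.
exists (fun b : {ffun 'I_n.+1 -> T} => (b ord_max, [ffun i => b (lift ord_max i)])).
  move=> [l b] _ /=; rewrite ffun_snoc_max; congr pair; apply/ffunP => i.
  by rewrite ffunE ffun_snoc_lift.
move=> b _ /=; apply/ffunP => i; rewrite ffunE.
by case: unliftP => [j|] ->; rewrite ?ffunE.
Qed.

Lemma chain_snoc D n M (b : {ffun 'I_n.+1 -> 'I_M}) (l : 'I_M) :
  chain D (ffun_snoc b l) = chain D b && letter_step (D n) (b ord_max) l.
Proof.
apply/idP/andP=> [ch|[ch st]].
  split.
    apply/forallP=> i; apply/forallP=> j; apply/implyP=> ij.
    have := forallP (forallP ch (lift ord_max i)) (lift ord_max j).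
    by rewrite !ffun_snoc_lift !lift_max ij.
  have := forallP (forallP ch (lift ord_max ord_max)) ord_max.
  by rewrite ffun_snoc_lift ffun_snoc_max lift_max eqxx.
apply/forallP=> i; apply/forallP=> j; apply/implyP=> ij.
case: (unliftP ord_max i) ij => [i'|] -> ij; last first.
  by have := ltn_ord j; rewrite (eqP ij) /= ltnn.
rewrite ffun_snoc_lift lift_max in ij *.
case: (unliftP ord_max j) ij => [j'|] -> ij.
  rewrite ffun_snoc_lift; rewrite lift_max in ij.
  by have := forallP (forallP ch i') j'; rewrite ij.
rewrite ffun_snoc_max; move: ij; rewrite /= eqSS => /eqP ij.
by rewrite -ij (_ : i' = ord_max) //; apply: val_inj.
Qed.

Lemma sum_chain_last D n M (l : 'I_M) :
  \sum_(b : {ffun 'I_n.+1 -> 'I_M} | chain D b && (b ord_max == l))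
     \prod_i letter_wt (b i) = end_wt D n l.
Proof.
elim: n l => [|n IHn] l.
  rewrite (big_pred1 [ffun=> l]) => [|b] /=.
    by rewrite big_ord1 ffunE mulr1.
  apply/andP/eqP => [[_ /eqP bl]|->].
    by apply/ffunP=> i; rewrite ffunE -bl ord1; congr (b _); apply: val_inj.
  rewrite ffunE; split=> //; apply/forallP=> i; apply/forallP=> j.
  by rewrite !ord1.
rewrite big_ffun_snoc (bigD1 l) //= [X in _ + X]big1 ?addr0 => [|l' l'l]; last first.
  by rewrite big_pred0 // => b; rewrite ffun_snoc_max (negbTE l'l) andbF.
rewrite (eq_bigl (fun b : {ffun 'I_n.+1 -> 'I_M} =>
    chain D b && letter_step (D n) (b ord_max) l)) => [|b]; last first.
  by rewrite ffun_snoc_max eqxx andbT chain_snoc.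
rewrite (eq_bigr (fun b : {ffun 'I_n.+1 -> 'I_M} =>
    letter_wt l * \prod_i letter_wt (b i))) => [|b _]; last first.
  rewrite big_ord_recr /= ffun_snoc_max mulrC; congr (_ * _).
  apply: eq_bigr => i _; rewrite (_ : widen_ord _ _ = lift ord_max i) ?ffun_snoc_lift //.
  by apply: val_inj; exact: (esym (lift_max i)).
rewrite -big_distrr; congr (_ * _).
rewrite (partition_big (fun b : {ffun 'I_n.+1 -> 'I_M} => b ord_max)
           (fun l' : 'I_M => letter_step (D n) l' l)) /= => [|b /andP[]//].
rewrite [RHS](big_ord_widen_cond M (fun l' => letter_step (D n) l' l)
   (fun l' => end_wt D n l')) //.
apply: eq_big => [l'|l' st].
  by rewrite /letter_step ltnS; case: ltngtP => _; rewrite ?andbT ?andbF.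
rewrite -IHn; apply: eq_bigl => b; rewrite -andbA; congr (_ && _).
by case: eqP => [->|]; rewrite ?andbF ?st.
Qed.

Lemma sum_chain D n M :
  \sum_(b : {ffun 'I_n.+1 -> 'I_M} | chain D b) \prod_i letter_wt (b i) =
  \sum_(l < M) end_wt D n l.
Proof.
rewrite (partition_big (fun b : {ffun 'I_n.+1 -> 'I_M} => b ord_max) predT) //=.
by apply: eq_bigr => l _; rewrite sum_chain_last.
Qed.

(** The two series record the words whose last letter is at most 2j,
    respectively at most 2j - 1. An ascent lets the next letter 2j follow the
    former and a descent lets it follow the latter, whence the recurrences
    [even_seriesS_asc] to [odd_seriesS_desc]. *)
Definition even_series D n : {fps R} :=
  FPS (fun j => \sum_(l < j.*2.+1) end_wt D n l).
Definition odd_series D n : {fps R} :=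
  FPS (fun j => \sum_(l < j.*2) end_wt D n l).

Lemma end_wtS D n l :
  end_wt D n.+1 l =
  letter_wt l * \sum_(l' < l + (odd l == D n)) end_wt D n l'.
Proof.
rewrite /=; congr (_ * _); rewrite (_ : (l + _)%N = if odd l == D n then l.+1 else l); last first.
  by case: (_ == _); rewrite ?addn0 ?addn1.
rewrite big_mkcond big_ord_recr /= /letter_step ltnn eqxx /=.
rewrite (eq_bigr (fun l' : 'I_l => end_wt D n l')) => [|l' _]; last first.
  by rewrite ltn_ord.
by case: ifP => _; rewrite ?addr0 ?[RHS]big_ord_recr.
Qed.

Let t : {fps R} := fps_var.
Let Y : {fps R} := fps_const y.

Lemma fpscoef_1BvarM (f : {fps R}) n :
  fpscoef ((1 - t) * f) n = fpscoef f n - (if n is m.+1 then fpscoef f m else 0).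
Proof. by rewrite mulrBl mul1r fpscoefB fpscoef_varM. Qed.

(** Multiplying by 1 - t takes differences of consecutive coefficients, which
    leaves the last two letters only. *)
Lemma diff_even_series D n j :
  fpscoef ((1 - t) * even_series D n) j =
  end_wt D n j.*2 + if j is i.+1 then end_wt D n i.*2.+1 else 0.
Proof.
rewrite fpscoef_1BvarM; case: j => [|j] /=.
  by rewrite big_ord1 subr0 addr0.
by rewrite doubleS 2![in X in X - _]big_ord_recr /=; ring.
Qed.

Lemma diff_odd_series D n j :
  fpscoef ((1 - t) * odd_series D n) j =
  if j is i.+1 then end_wt D n i.*2 + end_wt D n i.*2.+1 else 0.
Proof.
rewrite fpscoef_1BvarM; case: j => [|j] /=; first by rewrite big_ord0 subr0.
by rewrite doubleS 2![in X in X - _]big_ord_recr /=; ring.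
Qed.

Lemma even_seriesS_asc D n : D n = false ->
  (1 - t) * even_series D n.+1 = (1 + Y * t) * even_series D n.
Proof.
move=> Dn; apply: fpsP => j; rewrite diff_even_series mulrDl mul1r -mulrA.
rewrite fpscoefD fpscoef_constM fpscoef_varM end_wtS Dn /letter_wt odd_double.
rewrite mul1r addn1; case: j => [|j]; first by rewrite mulr0.
by rewrite end_wtS Dn /letter_wt /= odd_double /= addn0.
Qed.

Lemma even_seriesS_desc D n : D n ->
  (1 - t) * even_series D n.+1 = (1 + Y) * odd_series D n.
Proof.
move=> Dn; apply: fpsP => j; rewrite diff_even_series mulrDl mul1r.
rewrite fpscoefD fpscoef_constM end_wtS Dn /letter_wt odd_double.
rewrite mul1r addn0; case: j => [|j]; first by rewrite /= big_ord0 mulr0.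
by rewrite end_wtS Dn /letter_wt /= odd_double /= addn1.
Qed.

Lemma odd_seriesS_asc D n : D n = false ->
  (1 - t) * odd_series D n.+1 = (1 + Y) * t * even_series D n.
Proof.
move=> Dn; apply: fpsP => j; rewrite diff_odd_series -mulrA mulrDl mul1r.
rewrite fpscoefD fpscoef_constM fpscoef_varM.
case: j => [|j]; first by rewrite mulr0 addr0.
by rewrite !end_wtS Dn /letter_wt /= odd_double /= addn0 mul1r addn1.
Qed.

Lemma odd_seriesS_desc D n : D n ->
  (1 - t) * odd_series D n.+1 = (Y + t) * odd_series D n.
Proof.
move=> Dn; apply: fpsP => j; rewrite diff_odd_series mulrDl.
rewrite fpscoefD fpscoef_constM fpscoef_varM.
case: j => [|j]; first by rewrite /= big_ord0 mulr0 addr0.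
by rewrite !end_wtS Dn /letter_wt /= odd_double /= addn0 mul1r addn1 addrC.
Qed.

End Chains.

(** * The series of a descent pattern *)

Section ChainStatistics.
Variables (R : comUnitRingType) (y : R).
Hypothesis Uy : y \is a GRing.unit.
Implicit Types (D : nat -> bool) (n : nat).

Let t : {fps R} := fps_var.
Let Y : {fps R} := fps_const y.
Let u : {fps R} := (1 + Y) ^+ 2 * t / ((Y + t) * (1 + Y * t)).
Let v : {fps R} := (Y + t) / (1 + Y * t).

(** The statistics of a descent pattern on n steps; in [count_left_peak] the
    predecessor of 0 is 0 itself, hence the explicit case i = 0. *)
Definition count_desc D n : nat := \sum_(i < n) D i.
Definition count_left_peak D n : nat :=
  \sum_(i < n) (D i && ((i == 0 :> nat) || ~~ D i.-1)).

Let U1t : 1 - t \is a GRing.unit.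
Proof. by rewrite fps_unitE fpscoefB subr0 unitr1. Qed.
Let U1Yt : 1 + Y * t \is a GRing.unit.
Proof. by rewrite fps_unitE fpscoefD fpscoef_constM mulr0 addr0 unitr1. Qed.
Let UYt : Y + t \is a GRing.unit.
Proof. by rewrite fps_unitE fpscoefD /= addr0. Qed.

(** Closed form of the even series after n steps, that is for words of n + 1
    letters. *)
Definition chain_series D n : {fps R} :=
  (1 + Y * t) ^+ n.+1 / (1 - t) ^+ n.+2
  * u ^+ count_left_peak D n * v ^+ count_desc D n.

Lemma chain_seriesS D n :
  (1 - t) * chain_series D n.+1 =
  (1 + Y * t) * chain_series D n *
  u ^+ (D n && ((n == 0) || ~~ D n.-1)) * v ^+ D n.
Proof.
rewrite /chain_series /count_left_peak /count_desc !big_ord_recr /= !exprD.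
rewrite [(1 + Y * t) ^+ n.+2]exprS [(1 - t) ^+ n.+3]exprS invrM ?unitrX //.
rewrite -[RHS]mul1r -[X in _ = X * _](mulrV U1t); ring.
Qed.

Lemma end_wt0 D l : end_wt y D 0 l = letter_wt y l.
Proof. exact: mulr1. Qed.

Lemma even_series0 D :
  (1 - t) * ((1 - t) * even_series y D 0) = 1 + Y * t.
Proof.
apply: fpsP => j; rewrite fpscoef_1BvarM fpscoefD fpscoef_constM.
case: j => [|[|j]]; rewrite !diff_even_series !end_wt0 /letter_wt /=.
- by rewrite mulr0 subr0.
- ring.
- by rewrite !odd_double /= mulr0; ring.
Qed.

Lemma odd_series0 D :
  (1 - t) * ((1 - t) * odd_series y D 0) = (1 + Y) * t.
Proof.
rewrite [RHS]mulrDl mul1r; apply: fpsP => j; rewrite fpscoef_1BvarM fpscoefD fpscoef_constM.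
case: j => [|[|j]]; rewrite !diff_odd_series ?end_wt0 /letter_wt /=.
- by rewrite mulr0 subr0 addr0.
- ring.
- by rewrite !odd_double /= mulr0; ring.
Qed.

(** After any step the two series are proportional, with a ratio that depends
    only on the kind of this step: the second conjunct. The start behaves as if
    it followed an ascent, which matches the convention that a descent in first
    position is a left peak. A descent thus multiplies the even series by
    (1+yt)/(1-t) * v after a descent and by (1+yt)/(1-t) * uv otherwise. *)
Lemma even_series_eq D n :
  even_series y D n = chain_series D n /\
  (if (n == 0)%N || ~~ D n.-1
   then odd_series y D n * (1 + Y * t) = t * (1 + Y) * even_series y D n
   else odd_series y D n * (1 + Y) = (Y + t) * even_series y D n).
Proof.
elim: n => [|n [IHe IHo]].
  have U11t: (1 - t) ^+ 2 \is a GRing.unit by rewrite unitrX.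
  split; apply: (mulrI U11t).
    rewrite expr2 -mulrA even_series0 -expr2 /chain_series /count_left_peak.
    by rewrite /count_desc !big_ord0 !mulr1 mulrCA mulrV ?mulr1.
  rewrite !expr2 mulrA -[_ * _ * odd_series _ _ _]mulrA odd_series0.
  rewrite [RHS]mulrCA -[_ * _ * even_series _ _ _]mulrA even_series0; ring.
case Dn: (D n).
  have recE : (1 - t) * even_series y D n.+1 = (1 + Y) * odd_series y D n.
    exact: even_seriesS_desc.
  have recO : (1 - t) * odd_series y D n.+1 = (Y + t) * odd_series y D n.
    exact: odd_seriesS_desc.
  split; last first.
    rewrite /= ?Dn /=; apply: (mulrI U1t); rewrite mulrA recO.
    rewrite [RHS]mulrCA recE; ring.
  apply: (mulrI U1t); rewrite chain_seriesS ?Dn recE -IHe /=.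
  case: ifP IHo => _ IHo.
    (* u * v = (1 + Y)^2 t / (1 + Y t)^2, the factor Y + t cancelling *)
    apply: (mulIr U1Yt); rewrite -[LHS]mulrA IHo !expr1 /u.
    have ->: v = (Y + t) * (1 + Y * t)^-1 by [].
    rewrite invrM // -[LHS]mulr1 -[X in _ * X = _](mulrV U1Yt).
    rewrite -[LHS]mulr1 -[X in _ * X = _](mulrV U1Yt).
    rewrite -[LHS]mulr1 -[X in _ * X = _](mulrV UYt); ring.
  rewrite expr0 mulr1 expr1 [LHS]mulrC IHo /v.
  rewrite -[LHS]mulr1 -[X in _ * X = _](mulrV U1Yt); ring.
have recE : (1 - t) * even_series y D n.+1 = (1 + Y * t) * even_series y D n.
  exact: even_seriesS_asc.
have recO : (1 - t) * odd_series y D n.+1 = (1 + Y) * t * even_series y D n.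
  exact: odd_seriesS_asc.
split; last first.
  rewrite /= ?Dn /=; apply: (mulrI U1t); rewrite mulrA recO.
  rewrite [RHS]mulrCA recE; ring.
by apply: (mulrI U1t); rewrite chain_seriesS ?Dn recE -IHe /= !mulr1.
Qed.

End ChainStatistics.

(** * Descents and left peaks of a permutation *)

Section PermutationStatistics.
Variables (n : nat) (s : 'S_n.+1).

(** Descents as a predicate on natural numbers, false from position n on. *)
Definition descent_at (i : nat) : bool :=
  [exists h : 'I_n.+1, (h == i :> nat) && is_descent s h].

Lemma descent_at_ord (i : 'I_n.+1) : descent_at i = is_descent s i.
Proof.
apply/existsP/idP => [[h /andP[/eqP/val_inj-> //]]|Di].
by exists i; rewrite eqxx.
Qed.

Lemma descent_atS (i j : 'I_n.+1) : j = i.+1 :> nat ->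
  descent_at i = (s j < s i)%N.
Proof.
move=> ji; rewrite descent_at_ord; apply/existsP/idP => [[j' /andP[/eqP j'i]]|].
  by rewrite (_ : j' = j) //; apply: val_inj; rewrite /= j'i.
by exists j; rewrite ji eqxx.
Qed.

Lemma descent_at_last : descent_at n = false.
Proof.
apply/existsP => -[h /andP[/eqP hn /existsP[j /andP[/eqP jh _]]]].
by have := ltn_ord j; rewrite jh hn ltnn.
Qed.

Lemma desE : des s = count_desc descent_at n.
Proof.
rewrite /des -sum1_card big_mkcond /count_desc.
rewrite (eq_bigr (fun i : 'I_n.+1 => descent_at i : nat)) => [|i _].
  by rewrite big_ord_recr /= descent_at_last addn0.
by rewrite inE descent_at_ord; case: is_descent.
Qed.

Lemma lpkE : lpk s = count_left_peak descent_at n.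
Proof.
rewrite /lpk -sum1_card big_mkcond /count_left_peak.
pose F (i : nat) : nat := descent_at i && ((i == 0%N) || ~~ descent_at i.-1).
rewrite (eq_bigr (fun i : 'I_n.+1 => F i)) => [|i _].
  by rewrite big_ord_recr /= /F descent_at_last addn0.
rewrite inE /is_left_peak /F -descent_at_ord andbC.
case: descent_at => //=; case: (i =P 0 :> nat) => //= /eqP; rewrite -lt0n => i0.
have lt_i : (i.-1 < n.+1)%N by rewrite (leq_ltn_trans (leq_pred _)).
pose h := Ordinal lt_i; have ih : i = h.+1 :> nat by rewrite /= prednK.
rewrite (descent_atS ih) -leqNgt leq_eqVlt.
have /negbTE-> : (s h : nat) != s i.
  rewrite (inj_eq val_inj) (inj_eq perm_inj); apply/eqP => hi.
  by move: ih; rewrite hi => /n_Sn.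
rewrite (_ : [exists _, _] = (s h < s i)%N); first by case: ltnP.
apply/existsP/idP => [[h' /andP[/eqP ih']]|]; last by exists h; rewrite ih eqxx.
by rewrite (_ : h' = h) //; apply: val_inj; apply: succn_inj; rewrite -ih'.
Qed.

End PermutationStatistics.

Lemma fpscoef_chain_series (R : comUnitRingType) (y : R) n (s : 'S_n.+1) k :
  y \is a GRing.unit ->
  let t : {fps R} := fps_var in let Y := fps_const y in
  fpscoef ((1 + Y * t) ^+ n.+1 / (1 - t) ^+ n.+2
           * ((1 + Y) ^+ 2 * t / ((Y + t) * (1 + Y * t))) ^+ lpk s
           * ((Y + t) / (1 + Y * t)) ^+ des s) k =
  \sum_(b : {ffun 'I_n.+1 -> 'I_k.*2.+1} | chain (descent_at s) b)
     \prod_i letter_wt y (b i).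
Proof.
move=> Uy t Y; have [eqE _] := even_series_eq Uy (descent_at s) n.
by rewrite desE lpkE -[fpscoef _ k]/(fpscoef (chain_series y (descent_at s) n) k)
  -eqE sum_chain.
Qed.

(** * Involutions with a compatible word *)

Section LabelledInvolutions.
Variables n L : nat.
Implicit Types (s : 'S_n) (b : {ffun 'I_n -> 'I_L}).

(** The condition is imposed on all pairs of positions rather than on adjacent
    ones: s is monotone on each set of positions carrying the same letter.
    [chain_compatible] compares the two forms. *)
Definition compatible s b : bool :=
  [forall m : 'I_n, forall m' : 'I_n, (m < m')%N ==>
     ((b m < b m')%N || (b m == b m') && (odd (b m) == (s m' < s m)%N))].

Lemma compatibleP s b (m m' : 'I_n) : compatible s b -> (m < m')%N ->
  (b m < b m')%N \/ b m = b m' /\ odd (b m) = (s m' < s m)%N.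
Proof.
move=> /forallP/(_ m)/forallP/(_ m')/implyP cmp lt_m.
have /orP[|/andP[/eqP ? /eqP]] := cmp lt_m; by [left|right].
Qed.

Definition block s b (i j : 'I_L) : {set 'I_n} :=
  [set m | (b m == i) && (b (s m) == j)].

End LabelledInvolutions.

(** * The involution encoded by a symmetric matrix *)

Section Cells.
Variables n L : nat.
Variable A : 'I_L -> 'I_L -> nat.

Local Notation cell := ('I_L * 'I_L * 'I_n.+1)%type.
Implicit Types (e : cell) (phi : 'I_n -> cell).

(** A cell (i, j, c) stands for the c-th position among those with the letter i
    whose image has the letter j. *)
Definition cells : {set cell} := [set e : cell | (e.2 < A e.1.1 e.1.2)%N].

(** Positions with a barred letter are reversed by the involution, hence the
    reversal of c. When i and j have different types, [mixA] below makes c = 0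
    the only possibility, so that testing i or j is the same. *)
Definition flip e : cell :=
  (e.1.2, e.1.1,
   if odd e.1.1 then inord ((A e.1.1 e.1.2).-1 - e.2) else e.2).

(** The lexicographic order on cells, in which j is reversed when i is barred;
    an injective numerical key makes it total for free. *)
Definition cell_key e : nat :=
  ((e.1.1 * L + (if odd e.1.1 then L.-1 - e.1.2 else e.1.2)) * n.+1 + e.2)%N.

Lemma lex_ltn B a c a' c' : (c < B)%N -> (c' < B)%N ->
  (a * B + c < a' * B + c')%N = (a < a')%N || (a == a') && (c < c')%N.
Proof. by move=> cB c'B; case: (ltngtP a a') => [lt|lt|->] /=; nia. Qed.

Lemma cell_key_lt e e' :
  (cell_key e < cell_key e')%N =
  [|| (e.1.1 < e'.1.1)%N,
      (e.1.1 == e'.1.1) &&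
        (if odd e.1.1 then (e'.1.2 < e.1.2)%N else (e.1.2 < e'.1.2)%N)
    | (e.1 == e'.1) && (e.2 < e'.2)%N].
Proof.
case: e e' => [[i j] c] [[i' j'] c']; rewrite /cell_key /= lex_ltn //.
have ltL (k l : 'I_L) : ((if odd k then L.-1 - l else l) < L)%N.
  by case: (odd k); have := ltn_ord l; lia.
have eqL (k l l' : 'I_L) : ((if odd k then L.-1 - l else l) ==
    (if odd k then L.-1 - l' else l') :> nat)%N = (l == l').
  rewrite -(inj_eq val_inj) /=.
  by case: (odd k); have := ltn_ord l; have := ltn_ord l'; lia.
rewrite lex_ltn // xpair_eqE -(inj_eq val_inj i) /= -orbA; congr (_ || _).
case: (i =P i' :> nat) => [/val_inj <-|ne] /=; last first.
  rewrite (_ : _ == _ = false) //; apply/eqP => eq_key.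
  have := ltL i j; have := ltL i' j'; nia.
rewrite eqn_add2l eqL; congr (_ || _).
by case: (odd i); have := ltn_ord j; have := ltn_ord j'; lia.
Qed.

Lemma cell_key_inj : injective cell_key.
Proof.
move=> e e' eq_key; have := cell_key_lt e e'; have := cell_key_lt e' e.
rewrite eq_key ltnn; case: e e' {eq_key} => [[i j] c] [[i' j'] c'] /=.
move=> /esym/norP[+ /norP[]] + + /esym/norP[+ /norP[]].
rewrite !xpair_eqE -!(inj_eq val_inj) /= => h1 h2 h3 h4 h5 h6.
have /val_inj ii : i = i' :> nat by lia.
subst i'; rewrite eqxx /= in h2 h3 h5 h6.
have /val_inj jj : j = j' :> nat by move: h2 h5; case: (odd i); lia.
subst j'; rewrite eqxx /= in h3 h6.
by congr (_, _); apply: val_inj => /=; lia.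
Qed.

Definition enumerates phi :=
  (forall m, phi m \in cells) /\
  (forall m m' : 'I_n, (m < m')%N -> (cell_key (phi m) < cell_key (phi m'))%N).

(** The pair (s, b) is the one encoded by the matrix A: the increasing numbering
    of the cells carries the first coordinate to b and [flip] to s. *)
Definition models (s : 'S_n) (b : {ffun 'I_n -> 'I_L}) :=
  exists phi, [/\ enumerates phi, forall m, b m = (phi m).1.1
                & forall m, phi (s m) = flip (phi m)].

Hypothesis sumA : (\sum_(p : 'I_L * 'I_L) A p.1 p.2)%N = n.

Lemma entry_le i j : (A i j <= n)%N.
Proof. by rewrite -[X in (_ <= X)%N]sumA (bigD1 (i, j)) //= leq_addr. Qed.

Lemma big_cells (T : Type) (idx : T) (op : Monoid.com_law idx) (F : cell -> T) :
  \big[op/idx]_(e in cells) F e =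
  \big[op/idx]_(p : 'I_L * 'I_L) \big[op/idx]_(c < A p.1 p.2) F (p, inord c).
Proof.
transitivity (\big[op/idx]_(p : 'I_L * 'I_L)
    \big[op/idx]_(c < n.+1 | (c < A p.1 p.2)%N) F (p, c)).
  by rewrite pair_big_dep; apply: eq_big => -[p c] //; rewrite inE.
apply: eq_bigr => p _; rewrite [RHS](big_ord_widen n.+1 (fun c => F (p, inord c))).
  by apply: eq_bigr => c _; rewrite inord_val.
by rewrite ltnW // ltnS entry_le.
Qed.

Lemma card_cells : #|cells| = n.
Proof.
rewrite -sum1_card big_cells -[RHS]sumA; apply: eq_bigr => p _.
by rewrite sum1_card card_ord.
Qed.

Section Enumeration.
Variable phi : 'I_n -> cell.
Hypothesis phiP : enumerates phi.

Lemma enumerates_lt (m m' : 'I_n) :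
  (cell_key (phi m) < cell_key (phi m'))%N = (m < m')%N.
Proof.
case: phiP => _ phi_lt; case: (ltngtP m m') => [/phi_lt//|/phi_lt lt|/val_inj->].
  by rewrite ltnNge ltnW.
by rewrite ltnn.
Qed.

Lemma enumerates_inj : injective phi.
Proof.
move=> m m' eq_phi; case: (ltngtP m m') => [||/val_inj//];
  by rewrite -enumerates_lt eq_phi ltnn.
Qed.

Lemma enumerates_im : phi @: 'I_n = cells.
Proof.
apply/eqP; rewrite eqEcard card_cells card_imset ?card_ord ?leqnn ?andbT.
  by apply/subsetP => e /imsetP[m _ ->]; case: phiP.
exact: enumerates_inj.
Qed.

Lemma enumerates_onto e : e \in cells -> exists m, e = phi m.
Proof. by rewrite -enumerates_im => /imsetP[m _ ->]; exists m. Qed.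

Lemma big_enumerates (T : Type) (idx : T) (op : Monoid.com_law idx)
    (F : cell -> T) :
  \big[op/idx]_m F (phi m) = \big[op/idx]_(e in cells) F e.
Proof.
rewrite -enumerates_im big_imset //=.
by move=> m m' _ _; apply: enumerates_inj.
Qed.

(** The number of a cell is the number of smaller cells, so the increasing
    numbering is unique. *)
Lemma enumerates_rank m : #|[set e in cells | (cell_key e < cell_key (phi m))%N]| = m.
Proof.
rewrite (_ : [set e in cells | _] = phi @: [set m' : 'I_n | (m' < m)%N]).
  rewrite card_imset; last exact: enumerates_inj.
  rewrite -sum1_card (eq_bigl (fun m' : 'I_n => (m' < m)%N)) => [|m'].
    rewrite -(big_ord_widen n (fun=> 1%N)) ?sum1_card ?card_ord //.
    exact: ltnW.
  by rewrite inE.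
apply/setP => e; rewrite inE; apply/andP/imsetP => [[/enumerates_onto[m' ->]]|].
  by rewrite enumerates_lt => lt_m; exists m'; rewrite // inE.
by case=> m'; rewrite inE => lt_m ->; rewrite enumerates_lt; case: phiP.
Qed.

End Enumeration.

Lemma enumerates_uniq phi phi' : enumerates phi -> enumerates phi' -> phi =1 phi'.
Proof.
move=> phiP phiP' m; have [m' eq_m] := enumerates_onto phiP' (phiP.1 m).
rewrite eq_m; congr phi'; apply: val_inj => /=.
by rewrite -(enumerates_rank phiP' m') -eq_m enumerates_rank.
Qed.

Lemma enumerates_ex : exists phi, enumerates phi.
Proof.
pose r := sort (relpre cell_key leq) (enum cells).
have size_r : size r == n by rewrite size_sort -cardE card_cells.
have sorted_r : sorted ltn (map cell_key r).
  rewrite ltn_sorted_uniq_leq (map_inj_uniq cell_key_inj) sort_uniq enum_uniq.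
  by rewrite sorted_map sort_sorted // => e e'; apply: leq_total.
exists (tnth (Tuple size_r)); split=> [m|m m' lt_m].
  by rewrite -mem_enum -(mem_sort (relpre cell_key leq)) mem_tnth.
have e0 : cell := tnth (Tuple size_r) m.
rewrite !(tnth_nth e0) /= -!(nth_map e0 0%N) ?(eqP size_r) //.
by apply: (sorted_ltn_nth ltn_trans) => //; rewrite inE size_map (eqP size_r).
Qed.

Hypothesis symA : forall i j, A i j = A j i.
Hypothesis mixA : forall i j : 'I_L, odd i != odd j -> (A i j <= 1)%N.

Lemma flip_cells e : e \in cells -> flip e \in cells.
Proof.
case: e => [[i j] c]; rewrite !inE /flip /= symA => lt_c.
case: ifP => // _; rewrite inordK; last by have := entry_le j i; lia.
lia.
Qed.

Lemma flipK e : e \in cells -> flip (flip e) = e.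
Proof.
case: e => [[i j] c]; rewrite !inE /flip /= (symA j i) => lt_c.
congr (_, _); apply: val_inj; have leAn := entry_le i j.
have mix := @mixA i j.
case: (odd i) mix; case: (odd j) => /= mix; rewrite ?inordK //; try lia.
Qed.

Lemma models_ex : exists s b, models s b.
Proof.
have [phi phiP] := enumerates_ex.
have /fin_all_exists[f fP] m : exists m', flip (phi m) = phi m'.
  by apply: (enumerates_onto phiP); apply/flip_cells/phiP.1.
have f_inj : injective f.
  move=> m m' eq_f; apply: (enumerates_inj phiP).
  by rewrite -(flipK (phiP.1 m)) -(flipK (phiP.1 m')) !fP eq_f.
exists (perm f_inj), [ffun m => (phi m).1.1], phi.
by split=> // m; rewrite ?ffunE ?permE.
Qed.

Lemma models_uniq s b s' b' : models s b -> models s' b' -> s = s' /\ b = b'.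
Proof.
move=> [phi [phiP bE sE]] [phi' [phiP' bE' sE']].
have eq_phi := enumerates_uniq phiP phiP'.
split; last by apply/ffunP => m; rewrite bE bE' eq_phi.
apply/permP => m; apply: (enumerates_inj phiP).
by rewrite sE !eq_phi sE'.
Qed.

Section Model.
Variables (s : 'S_n) (b : {ffun 'I_n -> 'I_L}).
Hypothesis sbA : models s b.

Lemma models_invol : s \in involutions n.
Proof.
have [phi [phiP bE sE]] := sbA; rewrite inE; apply/eqP/permP => m.
rewrite expgS expg1 permM perm1; apply: (enumerates_inj phiP).
by rewrite !sE flipK // phiP.1.
Qed.

Lemma models_compatible : compatible s b.
Proof.
have [phi [phiP bE sE]] := sbA.
apply/forallP=> m; apply/forallP=> m'; apply/implyP=> lt_m.
rewrite -(enumerates_lt phiP (s m')) !bE !sE.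
have:= phiP.2 _ _ lt_m; have := phiP.1 m; have := phiP.1 m'.
case: (phi m) (phi m') => [[i j] c] [[i' j'] c']; rewrite !inE !cell_key_lt /=.
move=> ltc' ltc /or3P[-> //|/andP[/eqP eqi]|/andP[/eqP[eqi eqj] ltcc]].
  subst i'; rewrite eqxx ltnn /= => lt_j.
  rewrite orbC !xpair_eqE -!(inj_eq val_inj) /=.
  by case: (odd i) lt_j => lt_j; have := lt_j; lia.
subst i' j'; rewrite !eqxx !ltnn /= if_same /= in ltc' *.
have := @mixA i j; have := entry_le i j.
case: (odd i); case: (odd j) => //= leAn mix; rewrite ?inordK; try lia.
Qed.

(** The matrix can be read off from the pair that it encodes. *)
Lemma models_block i j : #|block s b i j| = A i j.
Proof.
have [phi [phiP bE sE]] := sbA.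
rewrite -sum1_card (eq_bigl (fun m => (phi m).1 == (i, j))) => [|m]; last first.
  by rewrite inE !bE sE /=; case: (phi m) => [[? ?] ?]; rewrite xpair_eqE.
rewrite big_mkcond (big_enumerates phiP _ (fun e => if e.1 == (i, j) then 1 else 0)%N).
rewrite big_cells (bigD1 (i, j)) //= [X in (_ + X)%N]big1 ?addn0 => [|p /negbTE p_ij].
  by rewrite (eq_bigr (fun=> 1%N)) ?sum1_card ?card_ord // => c _; rewrite eqxx.
by rewrite big1 // => c _; rewrite p_ij.
Qed.

End Model.
End Cells.

(** * The matrix of a compatible pair *)

Section BlockSizes.
Variables n L : nat.
Variables (s : 'S_n) (b : {ffun 'I_n -> 'I_L}).
Hypotheses (invol_s : s \in involutions n) (cmp : compatible s b).

Local Notation size_block := (fun i j => #|block s b i j|).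

Lemma involK : involutive s.
Proof.
move: invol_s; rewrite inE => /eqP s2 m.
by have := congr1 (fun r : 'S_n => r m) s2; rewrite expgS expg1 permM perm1.
Qed.

Lemma block_flip (m : 'I_n) i j : (s m \in block s b j i) = (m \in block s b i j).
Proof. by rewrite !inE involK andbC. Qed.

Lemma block_imset i j : s @: block s b i j = block s b j i.
Proof.
apply/setP => m; apply/imsetP/idP => [[m' mB ->]|mB]; first by rewrite block_flip.
by exists (s m); rewrite ?involK // block_flip.
Qed.

Lemma size_block_sym i j : size_block i j = size_block j i.
Proof. by rewrite /= -block_imset card_imset //; apply: perm_inj. Qed.

Lemma size_block_sum : (\sum_(p : 'I_L * 'I_L) size_block p.1 p.2)%N = n.
Proof.
rewrite -[RHS]card_ord -sum1_card.
rewrite (partition_big (fun m => (b m, b (s m))) predT) //=.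
apply: eq_bigr => -[i j] _; rewrite -sum1_card; apply: eq_bigl => m.
by rewrite inE xpair_eqE.
Qed.

Lemma block_monotone (i j : 'I_L) (m m' : 'I_n) :
  m \in block s b i j -> m' \in block s b i j -> (m < m')%N ->
  odd i = (s m' < s m)%N.
Proof.
rewrite !inE => /andP[/eqP bm _] /andP[/eqP bm' _] lt_m.
by case: (compatibleP cmp lt_m); rewrite bm bm' ?ltnn // => -[].
Qed.

(** On two positions of the block (i, j), s preserves or reverses the order
    according to the type of i; as s is its own inverse, applying this to the
    images shows that it does so according to the type of j too. *)
Lemma size_block_mix (i j : 'I_L) : odd i != odd j -> (size_block i j <= 1)%N.
Proof.
move=> ne_ij; apply/card_le1_eqP => m m' mB m'B; apply/eqP.
wlog lt_m : m m' mB m'B / (m < m')%N => [hw|].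
  case: (ltngtP m m') => [/hw|/hw|/val_inj->//]; first exact.
  by rewrite eq_sym; exact.
have odd_i := block_monotone mB m'B lt_m.
have sB : s m \in block s b j i by rewrite block_flip.
have sB' : s m' \in block s b j i by rewrite block_flip.
have odd_j : odd j = ~~ odd i.
  by case: (odd i) ne_ij; case: (odd j).
case: (ltngtP (s m) (s m')) => [lt_s|lt_s|/val_inj/perm_inj->//].
  have := block_monotone sB sB' lt_s; rewrite !involK odd_j odd_i.
  by lia.
have := block_monotone sB' sB lt_s; rewrite !involK odd_j odd_i.
by lia.
Qed.

Definition block_rank (m : 'I_n) : nat :=
  #|[set m' in block s b (b m) (b (s m)) | (m' < m)%N]|.

Lemma block_rank_lt (m : 'I_n) : (block_rank m < size_block (b m) (b (s m)))%N.
Proof.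
apply: proper_card; apply/properP; split.
  by apply/subsetP => m'; rewrite inE => /andP[].
by exists m; rewrite !inE ?eqxx // ltnn andbF.
Qed.

Lemma block_rank_homo (i j : 'I_L) (m m' : 'I_n) :
  m \in block s b i j -> m' \in block s b i j -> (m < m')%N ->
  (block_rank m < block_rank m')%N.
Proof.
rewrite inE => /andP[/eqP bm /eqP bsm]; rewrite inE => /andP[/eqP bm' /eqP bsm'] lt_m.
rewrite /block_rank bm bsm bm' bsm'; apply: proper_card; apply/properP; split.
  apply/subsetP => m1; rewrite !in_set => /andP[-> lt_m1].
  exact: ltn_trans lt_m.
by exists m; rewrite !inE ?bm ?bsm ?eqxx ?lt_m ?ltnn ?andbF.
Qed.

(** The block (b m, b (s m)) is mapped by s onto its transpose, increasingly or
    decreasingly according to the type of b m. *)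
Lemma block_rank_flip (m : 'I_n) :
  block_rank (s m) =
  (if odd (b m) then (size_block (b m) (b (s m))).-1 - block_rank m
   else block_rank m)%N.
Proof.
set i := b m; set j := b (s m); pose B := block s b i j.
have mB : m \in B by rewrite inE !eqxx.
have cmpB m' : m' \in B -> m' != m -> (s m' < s m)%N = (odd i == (m < m')%N).
  move=> m'B ne_m; case: (ltngtP m m') => [lt_m|lt_m|/val_inj eq_m].
  - by rewrite -(block_monotone mB m'B lt_m) eqb_id.
  - have := block_monotone m'B mB lt_m.
    have : s m' != s m by rewrite (inj_eq perm_inj).
    by rewrite -(inj_eq val_inj) /= => ne_s; case: (odd i); lia.
  by rewrite eq_m eqxx in ne_m.
have -> : block_rank (s m) = #|[set m' in B | (s m' < s m)%N]|.
  rewrite -(card_imset _ (@perm_inj _ s)) /block_rank involK -/i -/j.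
  congr #|pred_of_set _|; apply/setP => m'; rewrite in_set.
  apply/andP/imsetP => [[m'B lt_m]|[m1]].
    by exists (s m'); rewrite ?involK // inE block_flip m'B involK.
  by rewrite inE => /andP[m1B lt_m] ->; rewrite block_flip.
have -> : #|block s b i j| = #|B| by [].
have -> : block_rank m = #|[set m' in B | (m' < m)%N]| by [].
clearbody B.
have -> : [set m' in B | (s m' < s m)%N] =
          [set m' in B | (m' != m) && (odd i == (m < m')%N)].
  apply/setP => m'; rewrite !in_set; apply: andb_id2l => m'B.
  by case: (m' =P m) => [->|/eqP ne_m]; rewrite ?ltnn // cmpB.
case: (odd i) => /=; last first.
  apply: eq_card => m'; rewrite !in_set; congr (_ && _).
  by rewrite -(inj_eq val_inj) /=; lia.
rewrite (cardsD1 m B) mB add1n /=.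
rewrite -(cardsID [set m' : 'I_n | (m' < m)%N] (B :\ m)).
rewrite (_ : (B :\ m) :&: _ = [set m' in B | (m' < m)%N]); last first.
  apply/setP => m'; rewrite !inE -val_eqE /=.
  by case: (m' \in B); rewrite ?andbF //; lia.
rewrite addKn; apply: eq_card => m'; rewrite !inE -val_eqE /=.
by case: (m' \in B); rewrite ?andbF //; lia.
Qed.

(** A compatible pair is encoded by the matrix of its block sizes: the cell of a
    position m is (b m, b (s m), rank of m in its block). *)
Lemma models_size_block : models size_block s b.
Proof.
pose phi (m : 'I_n) : 'I_L * 'I_L * 'I_n.+1 := (b m, b (s m), inord (block_rank m)).
have rank_n (m : 'I_n) : (block_rank m < n.+1)%N.
  by rewrite (leq_trans (block_rank_lt m)) // ltnW // ltnS (entry_le size_block_sum).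
exists phi; split=> //; last first.
  move=> m; rewrite /phi /flip /= involK; congr (_, _); apply: val_inj.
  rewrite /= (inordK (rank_n _)) block_rank_flip.
  case: (odd _); rewrite ?inordK ?rank_n //.
  by rewrite ltnS (leq_trans (leq_subr _ _)) // (leq_trans (leq_pred _)) // (entry_le size_block_sum).
split=> [m|m m' lt_m].
  by rewrite inE /phi /= inordK ?block_rank_lt.
rewrite cell_key_lt /= !inordK ?rank_n //.
case: (compatibleP cmp lt_m) => [->//|[eq_b odd_b]].
rewrite -eq_b eqxx ltnn /= odd_b.
have ne_s : s m != s m' by rewrite (inj_eq perm_inj) neq_ltn lt_m.
case: (ltngtP (b (s m)) (b (s m'))) => [lt_bs|lt_bs|/val_inj eq_bs].
- case: ifP => // lt_s; case: (compatibleP cmp lt_s).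
    by move=> lt_bs'; rewrite ltnNge ltnW in lt_bs.
  by case=> eq_bs; rewrite eq_bs ltnn in lt_bs.
- case: ifP => // le_s; have lt_s : (s m < s m')%N.
    by rewrite ltn_neqAle ne_s leqNgt le_s.
  case: (compatibleP cmp lt_s) => [lt_bs'|[eq_bs _]].
    by rewrite ltnNge ltnW in lt_bs.
  by rewrite eq_bs ltnn in lt_bs.
rewrite -eq_bs xpair_eqE !eqxx /=.
rewrite (@block_rank_homo (b m) (b (s m)) m m') ?if_same ?orbT //.
  by rewrite inE !eqxx.
by rewrite inE eq_b eq_bs !eqxx.
Qed.

End BlockSizes.

(** * The weighted count of compatible pairs *)

(** A letter carried by two positions is carried by all positions in between, so
    the condition on adjacent positions propagates. *)
Lemma chain_compatible n L (s : 'S_n.+1) (b : {ffun 'I_n.+1 -> 'I_L}) :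
  chain (descent_at s) b = compatible s b.
Proof.
apply/idP/idP => ch; last first.
  apply/forallP=> i; apply/forallP=> j; apply/implyP=> /eqP ji.
  rewrite /letter_step (descent_atS s ji).
  have lt_ij : (i < j)%N by rewrite ji.
  by case: (compatibleP ch lt_ij) => [->//|[-> ->]]; rewrite !eqxx orbT.
apply/forallP=> m; apply/forallP=> m'; apply/implyP.
case: m' => k lt_k /=; elim: k lt_k => // k IHk lt_k.
have lt_k' := ltnW lt_k; pose j := Ordinal lt_k'; pose j' := Ordinal lt_k.
have := forallP (forallP ch j) j'; rewrite eqxx /= -/j'.
rewrite /letter_step (@descent_atS _ s j j') // => st; rewrite ltnS leq_eqVlt.
move=> /orP[/eqP mk|lt_mk].
  by have -> : m = j by apply: val_inj.
move: (IHk lt_k' lt_mk); rewrite -/j -!val_eqE /= => IH.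
case/orP: IH => [lt_b|/andP[/eqP eq_b /eqP odd_b]].
  by case/orP: st => [lt_b'|/andP[/eqP <- _]]; rewrite ?lt_b // (ltn_trans lt_b).
case/orP: st => [lt_b'|/andP[/eqP <- /eqP odd_b']]; first by rewrite eq_b lt_b'.
rewrite eq_b eqxx /=; apply/orP; right; apply/eqP.
have ne_s : (s m : nat) != s j'.
  by rewrite val_eqE (inj_eq perm_inj) -val_eqE /= neq_ltn ltnS ltnW.
have ne_s' : (s m : nat) != s j.
  by rewrite val_eqE (inj_eq perm_inj) -val_eqE /= neq_ltn lt_mk.
move: odd_b odd_b'; rewrite eq_b; case: (odd _); lia.
Qed.

(** Folds a square array onto its upper triangle and pads with neutral elements,
    so as to keep ordered pairs as indices. *)
Lemma big_fold_pairs (T : Type) (idx : T) (op : Monoid.com_law idx) L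
    (F : 'I_L -> 'I_L -> T) :
  \big[op/idx]_(p : 'I_L * 'I_L) F p.1 p.2 =
  \big[op/idx]_(p : 'I_L * 'I_L)
    (if p.1 == p.2 then F p.1 p.2
     else if (p.1 < p.2)%N then op (F p.1 p.2) (F p.2 p.1) else idx).
Proof.
pose G (p : 'I_L * 'I_L) := if (p.1 < p.2)%N then F p.2 p.1 else idx.
pose H (p : 'I_L * 'I_L) := if (p.1 <= p.2)%N then F p.1 p.2 else idx.
have eGH : \big[op/idx]_p G p = \big[op/idx]_p G (p.2, p.1).
  rewrite (reindex (fun p : 'I_L * 'I_L => (p.2, p.1))) //.
  by exists (fun p => (p.2, p.1)) => -[].
transitivity (\big[op/idx]_p op (H p) (G (p.2, p.1))).
  apply: eq_bigr => -[i j] _; rewrite /H /G /=.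
  by case: ltnP; rewrite ?Monoid.mul1m ?Monoid.mulm1.
rewrite big_split -eGH -big_split; apply: eq_bigr => -[i j] _.
rewrite /H /G /= leq_eqVlt -[i == j]val_eqE /=.
by case: ltngtP; rewrite ?Monoid.mul1m ?Monoid.mulm1.
Qed.

(** The reversal of {0, ..., a - 1} has a fixed point, its middle, exactly when
    a is odd. *)
Lemma prod_middle (R : comNzRingType) (z : R) a :
  \prod_(c < a) (if (a.-1 - c)%N == c then z else 1) = z ^+ odd a.
Proof.
have [odd_a|even_a] := boolP (odd a).
  have lt_h : (a./2 < a)%N by rewrite -[X in (_ < X)%N]odd_double_half odd_a; lia.
  rewrite (bigD1 (Ordinal lt_h)) //= [X in _ * X]big1 => [|c].
    have := odd_double_half a; rewrite odd_a mulr1 => eq_a.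
    by rewrite ifT //; apply/eqP; lia.
  rewrite -val_eqE /= => ne_c; rewrite ifF //; apply/eqP => eq_c.
  by have := odd_double_half a; rewrite odd_a; have := ltn_ord c; lia.
rewrite big1 // => c _; rewrite ifF //; apply/eqP => eq_c.
by have := odd_double_half a; rewrite (negbTE even_a); have := ltn_ord c; lia.
Qed.

Section BlockSeries.
Variables (R : comNzRingType) (y z : R) (n L : nat).

Local Notation wt := (letter_wt y).

(** Contribution of the pair of letters (i, j) when [a] positions m satisfy
    {b m, b (s m)} = {i, j}: for i < j these positions come in pairs, hence a is
    even. Pairs with i > j contribute the constant series 1. *)
Definition block_coef (i j : nat) (a : nat) : R :=
  if i == j then wt i ^+ a * z ^+ (if odd i then odd a : nat else a)
  else if (i < j)%N then
    (if ~~ odd a && ((odd i != odd j) ==> (a <= 2)%N)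
     then (wt i * wt j) ^+ a./2 else 0)
  else (a == 0%N)%:R.

Definition labelled_wt (sb : 'S_n * {ffun 'I_n -> 'I_L}) : R :=
  z ^+ fix_pts sb.1 * \prod_m wt (sb.2 m).

Local Notation table := {ffun 'I_L * 'I_L -> 'I_n.+1}.

(** A table u lists the exponents of x in the factors of the product: u (i, j)
    counts the positions of the blocks (i, j) and (j, i) together. This is the
    symmetric matrix with the given table. *)
Definition table_sizes (u : table) (i j : 'I_L) : nat :=
  if i == j then u (i, j) : nat else if (i < j)%N then (u (i, j))./2 else (u (j, i))./2.

Definition valid_table (u : table) : bool :=
  (\sum_p u p == n)%N &&
  [forall p : 'I_L * 'I_L,
     (p.1 == p.2) ||
     (if (p.1 < p.2)%N then ~~ odd (u p) && ((odd p.1 != odd p.2) ==> (u p <= 2)%N)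
      else u p == 0%N :> nat)].

Definition block_table (sb : 'S_n * {ffun 'I_n -> 'I_L}) : table :=
  [ffun p => inord
     (if p.1 == p.2 then #|block sb.1 sb.2 p.1 p.2|
      else if (p.1 < p.2)%N
      then #|block sb.1 sb.2 p.1 p.2| + #|block sb.1 sb.2 p.2 p.1| else 0)%N].

Lemma table_sizes_sym u (i j : 'I_L) : table_sizes u i j = table_sizes u j i.
Proof.
rewrite /table_sizes [j == i]eq_sym; case: eqP => [->//|ne_ij].
by case: ltngtP => // /val_inj.
Qed.

Lemma table_sizes_mix u (i j : 'I_L) : valid_table u -> odd i != odd j ->
  (table_sizes u i j <= 1)%N.
Proof.
move=> /andP[_ /forallP vu]; wlog lt_ij : i j / (i < j)%N => [hw|] ne.
  have [/hw//|/hw hw'|/val_inj eq_ij] := ltngtP i j; first exact.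
    by rewrite table_sizes_sym hw' // eq_sym.
  by rewrite eq_ij eqxx in ne.
have ne_ij : (i == j) = false by rewrite -val_eqE ltn_eqF.
have := vu (i, j); rewrite /table_sizes /= ne_ij lt_ij ne /=.
by move=> /andP[_]; case: (nat_of_ord (u _)) => [|[|[|]]].
Qed.

Lemma table_sizes_sum u : valid_table u ->
  (\sum_(p : 'I_L * 'I_L) table_sizes u p.1 p.2)%N = n.
Proof.
move=> /andP[/eqP sum_u /forallP vu].
rewrite (big_fold_pairs _ (table_sizes u)) -[RHS]sum_u.
apply: eq_bigr => -[i j] _; have := vu (i, j); rewrite /table_sizes /=.
rewrite [j == i]eq_sym; case: eqP => [->//|ne_ij] /=.
case: (ltngtP i j) => [lt_ij|lt_ij|/val_inj//]; last by move/eqP->.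
by case/andP => /even_halfK eu _; rewrite addnn eu.
Qed.

Lemma block_table_sizes s b u :
  models (table_sizes u) s b -> valid_table u -> block_table (s, b) = u.
Proof.
move=> mod vu.
have blockE := models_block (table_sizes_sum vu) mod.
case/andP: vu => _ /forallP vu.
apply/ffunP => -[i j]; rewrite ffunE /= !blockE; apply: val_inj.
have := vu (i, j); rewrite /table_sizes /= [j == i]eq_sym.
case: eqP => [->|ne_ij] /=; first by rewrite inord_val.
case: (ltngtP i j) => [lt_ij|lt_ij|/val_inj//]; last by move/eqP->; rewrite inordK.
by case/andP => /even_halfK eu _; rewrite addnn eu inord_val.
Qed.

Lemma block_tableE s b (i j : 'I_L) : s \in involutions n -> compatible s b ->
  block_table (s, b) (i, j) =
  (if i == j then #|block s b i j|
   else if (i < j)%N then (#|block s b i j|).*2 else 0)%N :> nat.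
Proof.
move=> inv_s cmp; rewrite ffunE /= -(size_block_sym b inv_s i j) addnn.
rewrite inordK // ltnS; case: eqP => [_|ne_ij].
  exact: entry_le (size_block_sum s b) i j.
case: ifP => // lt_ij.
rewrite -[X in (_ <= X)%N](size_block_sum s b) (bigD1 (i, j)) //= (bigD1 (j, i)) /=.
  by rewrite -(size_block_sym b inv_s i j) addnA addnn leq_addr.
by apply/eqP => -[/esym].
Qed.

Lemma block_table_valid s b : s \in involutions n -> compatible s b ->
  valid_table (block_table (s, b)).
Proof.
move=> inv_s cmp; apply/andP; split.
  rewrite -[X in _ == X](size_block_sum s b).
  rewrite [X in _ == X](big_fold_pairs _ (fun i j => #|block s b i j|)).
  apply/eqP/eq_bigr => -[i j] _; rewrite block_tableE //=.
  by rewrite -(size_block_sym b inv_s i j) addnn.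
apply/forallP => -[i j]; rewrite block_tableE //=.
case: eqP => //= _; case: ifP => lt_ij; rewrite lt_ij ?odd_double //=; apply/implyP => ne.
by rewrite -[2%N]/(1.*2)%N leq_double (size_block_mix inv_s cmp).
Qed.

Lemma table_sizes_block s b : s \in involutions n -> compatible s b ->
  forall i j, table_sizes (block_table (s, b)) i j = #|block s b i j|.
Proof.
move=> inv_s cmp i j; rewrite /table_sizes !block_tableE // [j == i]eq_sym.
case: eqP => // ne_ij; case: (ltngtP i j) => [_|_|/val_inj//]; rewrite doubleK //.
exact: size_block_sym.
Qed.

Lemma models_block_table s b : s \in involutions n -> compatible s b ->
  models (table_sizes (block_table (s, b))) s b.
Proof.
move=> inv_s cmp; have := models_size_block inv_s cmp.
rewrite (_ : (fun i j => _) = table_sizes (block_table (s, b))) //.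
apply: boolp.funext => i; apply: boolp.funext => j.
by rewrite table_sizes_block.
Qed.

(** Both the weight and the fixed points are read off cell by cell: a position
    is fixed when [flip] fixes its cell, which happens only for i = j, always if
    i is plain and for the middle c if i is barred. *)
Lemma models_wt u s b : models (table_sizes u) s b -> valid_table u ->
  labelled_wt (s, b) = \prod_(p : 'I_L * 'I_L) block_coef p.1 p.2 (u p).
Proof.
move=> [phi [phiP bE sE]] vu; set A := table_sizes u in phiP sE.
have sumA : (\sum_(p : 'I_L * 'I_L) A p.1 p.2)%N = n by apply: table_sizes_sum.
pose W (e : 'I_L * 'I_L * 'I_n.+1) := wt e.1.1 * (if flip A e == e then z else 1).
transitivity (\prod_m W (phi m)).
  rewrite /labelled_wt mulrC /W big_split; congr (_ * _).
    by apply: eq_bigr => m _; rewrite bE.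
  rewrite -big_mkcond -prodr_const /fix_pts; apply: eq_bigl => m.
  by rewrite inE -sE (inj_eq (enumerates_inj phiP)).
rewrite (big_enumerates sumA phiP) (big_cells sumA).
pose G (i j : 'I_L) := wt i ^+ A i j *
  (if i == j then z ^+ (if odd i then odd (A i i) : nat else A i i) else 1).
transitivity (\prod_(p : 'I_L * 'I_L) G p.1 p.2).
  apply: eq_bigr => -[i j] _; rewrite /W /G /= big_split /= prodr_const card_ord.
  have inordA c : (c <= A i j)%N -> (inord c : 'I_n.+1) = c :> nat.
    by move=> le_c; rewrite inordK // ltnS (leq_trans le_c) // (entry_le sumA).
  congr (_ * _); rewrite (eq_bigr (fun c : 'I_(A i j) =>
    if (i == j) && (odd i ==> (((A i j).-1 - c)%N == c)) then z else 1)).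
    case: (i =P j) => [<-|_] /=; last by rewrite big1.
    by case: (odd i); rewrite ?prod_middle ?prodr_const ?card_ord.
  move=> c _; rewrite /flip /= !xpair_eqE [j == i]eq_sym andbb.
  congr (if _ && _ then z else 1); case: (odd i); last by rewrite eqxx.
  rewrite -val_eqE /= (inordA c (ltnW (ltn_ord c))) inordA //.
  by rewrite (leq_trans (leq_subr _ _)) ?leq_pred.
rewrite (big_fold_pairs _ G); apply: eq_bigr => -[i j] _ /=.
rewrite /block_coef /G /= val_eqE [j == i]eq_sym.
case: (i =P j) => [<-|ne_ij]; first by rewrite /A /table_sizes eqxx.
rewrite !mulr1 /A -(table_sizes_sym u i j) -exprMn /table_sizes.
case/andP: vu => _ /forallP/(_ (i, j)) /=; move/eqP/negbTE: ne_ij => -> /=.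
by case: ifP => // _ ->.
Qed.

(** Group the compatible pairs by their tables: invalid tables contribute 0, and
    for each valid one the matrix encodes exactly one pair. *)
Lemma sum_labelled_wt :
  \sum_(s in involutions n)
     \sum_(b : {ffun 'I_n -> 'I_L} | compatible s b)
        z ^+ fix_pts s * \prod_m wt (b m) =
  \sum_(u : table | (\sum_p u p)%N == n) \prod_(p : 'I_L * 'I_L) block_coef p.1 p.2 (u p).
Proof.
rewrite pair_big_dep /= -/labelled_wt.
rewrite (eq_bigr labelled_wt) // (partition_big block_table valid_table) /=; last first.
  by move=> [s b] /andP[/= inv_s cmp]; apply: block_table_valid.
rewrite [RHS](bigID valid_table) /= [X in _ = _ + X]big1 ?addr0 => [|u]; last first.
  move=> /andP[sum_u]; rewrite /valid_table sum_u /= negb_forall.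
  move=> /existsP[[i j] /= /norP[ne_ij nu]].
  rewrite (bigD1 (i, j)) //= /block_coef val_eqE (negbTE ne_ij).
  by move: nu; case: ifP => _ /negbTE->; rewrite mul0r.
apply: eq_big => [u|u vu]; first by rewrite andbC; apply/idP/andP => [vu|[]//]; case/andP: (vu).
have symA := table_sizes_sym u.
have mixA i j := @table_sizes_mix u i j vu.
have sumA := table_sizes_sum vu.
have [s [b mod]] := models_ex sumA symA mixA.
rewrite (big_pred1 (s, b)) => [|[s' b']] /=; first exact: models_wt.
apply/andP/eqP => [[/andP[inv_s cmp] /eqP eq_u]|[-> ->]].
  have mod' := models_block_table inv_s cmp; rewrite eq_u in mod'.
  by have [-> ->] := models_uniq sumA mod' mod.
rewrite (models_invol sumA symA mixA mod) (models_compatible sumA mixA mod).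
by rewrite (block_table_sizes mod vu).
Qed.

Lemma sum_labelled_wt_series :
  \sum_(s in involutions n)
     \sum_(b : {ffun 'I_n -> 'I_L} | compatible s b)
        z ^+ fix_pts s * \prod_m wt (b m) =
  fpscoef (\prod_(p : 'I_L * 'I_L) FPS (block_coef p.1 p.2)) n.
Proof. by rewrite sum_labelled_wt fpscoef_prod. Qed.

End BlockSeries.

(** * The product side *)

Section ProductForm.
Variables (R : comUnitRingType) (y z : R).

Let x : {fps R} := fps_var.
Let Y : {fps R} := fps_const y.
Let Z : {fps R} := fps_const z.

Definition block_series (i j : nat) : {fps R} := FPS (block_coef y z i j).

Definition product_form k : {fps R} :=
  (1 + Z * x * Y) ^+ k * (1 + x ^+ 2 * Y) ^+ (k ^ 2 + k)%N
  / ((1 - Z * x) ^+ k.+1 * (1 - x ^+ 2) ^+ 'C(k.+1, 2)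
     * (1 - x ^+ 2 * Y ^+ 2) ^+ 'C(k.+1, 2)).

Lemma block_series_eq_even m : block_series m.*2 m.*2 = (1 - Z * x)^-1.
Proof.
have UZx : 1 - Z * x \is a GRing.unit.
  by rewrite fps_unitE fpscoefB fpscoef_constM mulr0 subr0 unitr1.
apply: (mulrI UZx); rewrite mulrV //; apply: fpsP => n.
rewrite mulrBl mul1r -mulrA fpscoefB fpscoef_constM fpscoef_varM /=.
rewrite /block_coef eqxx /letter_wt odd_double.
case: n => [|n]; first by rewrite !expr0 mulr0 subr0 mulr1.
by rewrite !expr1n !mul1r exprS subrr.
Qed.

Lemma block_series_eq_odd m :
  block_series m.*2.+1 m.*2.+1 = (1 + Z * x * Y) / (1 - x ^+ 2 * Y ^+ 2).
Proof.
have -> : Z * x * Y = fps_const (y * z) * x by rewrite rmorphM /= /Z /Y; ring.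
have -> : x ^+ 2 * Y ^+ 2 = fps_const (y ^+ 2) * x ^+ 2 by rewrite rmorphXn /= mulrC.
rewrite fps_inv_step2; apply: fpsP => n /=.
rewrite /block_coef eqxx /letter_wt /= odd_double /= -exprM.
rewrite -{1}[n]odd_double_half addnC -muln2 mulnC exprD -mulrA; congr (_ * _).
by case: (odd n); rewrite ?expr1 ?expr0 ?mulr1.
Qed.

Lemma block_series_lt i j : (i < j)%N ->
  block_series i j =
  if odd i != odd j then 1 + x ^+ 2 * Y
  else if odd i then (1 - x ^+ 2 * Y ^+ 2)^-1 else (1 - x ^+ 2)^-1.
Proof.
move=> lt_ij; have ne_ij : (i == j) = false by rewrite ltn_eqF.
case: (boolP (odd i != odd j)) => [ne|/negbNE/eqP eq_odd].
  apply: fpsP => n; rewrite fpscoefD [_ * Y]mulrC fpscoef_constM.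
  rewrite -[x ^+ 2]mul1r fpscoef_MvarXn /= /block_coef ne_ij lt_ij ne /=.
  have -> : letter_wt y i * letter_wt y j = y.
    by rewrite /letter_wt; case: (odd i) ne; case: (odd j); rewrite ?mul1r ?mulr1.
  case: n => [|[|[|n]]] /=; rewrite ?mulr0 ?addr0 ?add0r ?mulr1 ?andbF //.
have -> : (if odd i then (1 - x ^+ 2 * Y ^+ 2)^-1 else (1 - x ^+ 2)^-1)
          = (1 - fps_const (letter_wt y i * letter_wt y j) * x ^+ 2)^-1.
  rewrite /letter_wt -eq_odd; case: (odd i); rewrite ?mul1r ?rmorph1 ?mul1r //.
  by rewrite rmorphM /= mulrC -expr2.
have := fps_inv_step2 (letter_wt y i * letter_wt y j) 0.
rewrite rmorph0 mul0r addr0 mul1r => ->; apply: fpsP => n /=.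
rewrite /block_coef ne_ij lt_ij eq_odd eqxx /= andbT.
by case: (odd n); rewrite ?mulr0 ?mulr1.
Qed.

Lemma prod_parity (g : bool -> {fps R}) m :
  \prod_(i < m.*2) g (odd i) = (g false * g true) ^+ m.
Proof.
elim: m => [|m IHm]; first by rewrite big_ord0.
by rewrite doubleS !big_ord_recr /= IHm odd_double /= exprSr mulrA.
Qed.

(** The product over i <= j for a fixed j; below j = 2m there are m plain and m
    barred letters, below j = 2m + 1 there is one more plain letter. *)
Lemma row_even m :
  \prod_(i < m.*2.+1) block_series i m.*2 =
  ((1 - x ^+ 2)^-1 * (1 + x ^+ 2 * Y)) ^+ m * (1 - Z * x)^-1.
Proof.
rewrite big_ord_recr /= block_series_eq_even; congr (_ * _).
rewrite -(prod_parity (fun o => if o then 1 + x ^+ 2 * Y else (1 - x ^+ 2)^-1)).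
apply: eq_bigr => i _; rewrite block_series_lt // odd_double.
by case: (odd i).
Qed.

Lemma row_odd m :
  \prod_(i < m.*2.+2) block_series i m.*2.+1 =
  ((1 + x ^+ 2 * Y) * (1 - x ^+ 2 * Y ^+ 2)^-1) ^+ m.+1 * (1 + Z * x * Y).
Proof.
rewrite 2!big_ord_recr /= block_series_eq_odd block_series_lt //= odd_double /=.
have -> : \prod_(i < m.*2) block_series i m.*2.+1 =
    ((1 + x ^+ 2 * Y) * (1 - x ^+ 2 * Y ^+ 2)^-1) ^+ m.
  rewrite -(prod_parity (fun o => if o then (1 - x ^+ 2 * Y ^+ 2)^-1 else 1 + x ^+ 2 * Y)).
  apply: eq_bigr => i _; rewrite block_series_lt /= ?odd_double.
    by case: (odd i).
  by rewrite ltnS ltnW.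
by rewrite [_ ^+ m.+1]exprSr; ring.
Qed.

(** Passing from k to k + 1 adds the letters 2k + 1 and 2k + 2, that is two rows;
    the exponents follow from C(k+2, 2) = C(k+1, 2) + (k+1) and
    (k+1)^2 + (k+1) = k^2 + k + 2(k+1). *)
Lemma prod_block_series k :
  \prod_(p : 'I_k.*2.+1 * 'I_k.*2.+1) block_series p.1 p.2 = product_form k.
Proof.
transitivity (\prod_(j < k.*2.+1) \prod_(i < j.+1) block_series i j).
  rewrite -(pair_big xpredT xpredT (fun i j : 'I_k.*2.+1 => block_series i j)) /=.
  rewrite exchange_big /=; apply: eq_bigr => j _.
  rewrite [RHS](big_ord_widen k.*2.+1 (fun i => block_series i j)) //.
  rewrite [RHS]big_mkcond /=; apply: eq_bigr => i _.
  case: ltnP => // lt_ji; apply: fpsP => n /=.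
  by rewrite /block_coef gtn_eqF // ltnNge ltnW.
have U1 : 1 - Z * x \is a GRing.unit.
  by rewrite fps_unitE fpscoefB fpscoef_constM mulr0 subr0 unitr1.
have U2 : 1 - x ^+ 2 \is a GRing.unit.
  by rewrite fps_unitE fpscoefB fpscoef_varM subr0 unitr1.
have U3 : 1 - x ^+ 2 * Y ^+ 2 \is a GRing.unit.
  by rewrite fps_unitE fpscoefB -mulrA fpscoef_varM subr0 unitr1.
have -> : product_form k =
    (1 + Z * x * Y) ^+ k * (1 + x ^+ 2 * Y) ^+ (k ^ 2 + k)%N
    * ((1 - Z * x)^-1 ^+ k.+1 * (1 - x ^+ 2)^-1 ^+ 'C(k.+1, 2)
       * (1 - x ^+ 2 * Y ^+ 2)^-1 ^+ 'C(k.+1, 2)).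
  rewrite /product_form !invrM ?unitrM ?unitrX ?U1 ?U2 ?U3 // !exprVn.
  by congr (_ * _); rewrite mulrC [X in _ = X * _]mulrC.
elim: k => [|k IHk].
  rewrite big_ord1 (row_even 0) !expr0 !mul1r /=.
  by rewrite !mulr1.
rewrite doubleS binS bin1; set C := 'C(k.+1, 2) in IHk *.
rewrite 2!big_ord_recr /= IHk (row_even k.+1) row_odd !exprMn.
have -> : (k.+1 ^ 2 + k.+1 = k ^ 2 + k + k.+1 + k.+1)%N by lia.
by rewrite !exprD [(1 + Z * x * Y) ^+ k.+1]exprS [(1 - Z * x)^-1 ^+ k.+2]exprS; ring.
Qed.

End ProductForm.

(** * Series in two variables *)

Section Lifting.
Variable R : comUnitRingType.

Lemma fps_constV (c : R) : fps_const c^-1 = (fps_const c)^-1.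
Proof.
have [Uc|nUc] := boolP (c \is a GRing.unit); first exact: rmorphV.
by rewrite !invr_out // fps_unitE.
Qed.

(** While [fps_const] makes a series in t constant in x, [lift_x] makes a series
    in x constant in t. *)
Definition lift_x (f : {fps R}) : {fps {fps R}} :=
  FPS (fun n => fps_const (fpscoef f n)).

Fact lift_x_zmod : zmod_morphism lift_x.
Proof. by move=> f g; apply: fpsP => n /=; rewrite -rmorphB. Qed.

Fact lift_x_monoid : monoid_morphism lift_x.
Proof.
split=> [|f g]; apply: fpsP => n /=; first by rewrite rmorph_nat.
by rewrite rmorph_sum /=; apply: eq_bigr => i _; rewrite rmorphM.
Qed.

HB.instance Definition _ :=
  GRing.isZmodMorphism.Build {fps R} {fps {fps R}} lift_x lift_x_zmod.
HB.instance Definition _ :=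
  GRing.isMonoidMorphism.Build {fps R} {fps {fps R}} lift_x lift_x_monoid.

Lemma lift_xV (f : {fps R}) : lift_x f^-1 = (lift_x f)^-1.
Proof.
have [Uf|nUf] := boolP (f \is a GRing.unit); first exact: rmorphV.
by rewrite !invr_out // !fps_unitE.
Qed.

Lemma lift_x_var : lift_x fps_var = fps_var.
Proof. by apply: fpsP => n /=; rewrite rmorph_nat. Qed.

Lemma lift_x_const c : lift_x (fps_const c) = fps_const (fps_const c).
Proof. by apply: fpsP => n /=; rewrite rmorphMn. Qed.

Lemma xtcoef_constMx (f : {fps R}) n i j :
  xtcoef (fps_const f * fps_var ^+ n) i j = if i == n then fpscoef f j else 0.
Proof.
rewrite /xtcoef fpscoef_MvarXn; case: (ltngtP n i) => [lt_n||->] //=; last by rewrite subnn.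
by rewrite subn_eq0 leqNgt lt_n.
Qed.

Lemma xtcoef_liftMt (f : {fps R}) k i j :
  xtcoef (lift_x f * fps_const fps_var ^+ k) i j = if j == k then fpscoef f i else 0.
Proof.
rewrite /xtcoef -rmorphXn mulrC fpscoef_constM mulrC fpscoef_MvarXn.
case: (ltngtP k j) => [lt_k||->] //=; last by rewrite subnn.
by rewrite subn_eq0 leqNgt lt_k.
Qed.

Lemma fps_sum_to_powers_x (F : nat -> {fps {fps R}}) (c : nat -> {fps R}) :
  (forall m, F m = fps_const (c m.+1) * fps_var ^+ m.+1) ->
  fps_sum_to F (FPS (fun n => if n is 0%N then 0 else c n)).
Proof.
move=> FE i j; exists i => M le_iM; rewrite /xtcoef !fpscoef_sum.
under eq_bigr => m _ do rewrite FE -[fpscoef _ j]/(xtcoef _ i j) xtcoef_constMx.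
case: i le_iM => [|i] lt_iM; first by rewrite big1.
rewrite (bigD1 (Ordinal lt_iM)) //= eqxx big1 ?addr0 // => m.
by rewrite -val_eqE eqSS eq_sym /= => /negbTE->.
Qed.

Lemma fps_sum_to_powers_t (F : nat -> {fps {fps R}}) (f : nat -> {fps R}) :
  (forall k, F k = lift_x (f k) * fps_const fps_var ^+ k) ->
  fps_sum_to F (FPS (fun n => FPS (fun k => fpscoef (f k) n))).
Proof.
move=> FE i j; exists j.+1 => M lt_jM; rewrite /xtcoef !fpscoef_sum.
under eq_bigr => k _ do rewrite FE -[fpscoef _ j]/(xtcoef _ i j) xtcoef_liftMt.
rewrite (bigD1 (Ordinal lt_jM)) //= eqxx big1 ?addr0 // => k.
by rewrite -val_eqE eq_sym /= => /negbTE->.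
Qed.

End Lifting.

Lemma rmorph_I_lpk_des_fix (R S : comNzRingType) (f : {rmorphism R -> S})
    n (y t z : R) :
  f (I_lpk_des_fix n y t z) = I_lpk_des_fix n (f y) (f t) (f z).
Proof.
by rewrite rmorph_sum; apply: eq_bigr => s _; rewrite !rmorphM !rmorphXn.
Qed.

(** * The double count *)

Section Identity.
Variables (R : comUnitRingType) (y z : R).
Hypothesis Uy : y \is a GRing.unit.

Let t : {fps R} := fps_var.
Let Y : {fps R} := fps_const y.
Let Z : {fps R} := fps_const z.

Definition involution_series n : {fps R} :=
  (1 + Y * t) ^+ n / (1 - t) ^+ n.+1
  * I_lpk_des_fix n ((1 + Y) ^+ 2 * t / ((Y + t) * (1 + Y * t)))
      ((Y + t) / (1 + Y * t)) Z.

Lemma const_involution_series n :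
  let t' : {fps {fps R}} := fps_const t in
  let Y' : {fps {fps R}} := fps_const Y in
  fps_const (involution_series n) =
  (1 + Y' * t') ^+ n / (1 - t') ^+ n.+1
  * I_lpk_des_fix n ((1 + Y') ^+ 2 * t' / ((Y' + t') * (1 + Y' * t')))
      ((Y' + t') / (1 + Y' * t')) (fps_const Z).
Proof.
pose c := @fps_const {fps R}.
have cD : {morph c : a b / a + b} by apply: rmorphD.
have cN : {morph c : a / - a} by apply: rmorphN.
have cM : {morph c : a b / a * b} by apply: rmorphM.
have cX m : {morph c : a / a ^+ m} by apply: rmorphXn.
have cV : {morph c : a / a^-1} by apply: fps_constV.
have c1 : c 1 = 1 by apply: rmorph1.
rewrite /involution_series rmorphM rmorph_I_lpk_des_fix /= -/c.
by rewrite !cM !cV !cX !cM !cD !cN !cM !c1.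
Qed.

Lemma lift_product_form k :
  let x : {fps {fps R}} := fps_var in
  let Y' : {fps {fps R}} := fps_const Y in
  let Z' : {fps {fps R}} := fps_const Z in
  lift_x (product_form y z k) =
  (1 + Z' * x * Y') ^+ k * (1 + x ^+ 2 * Y') ^+ (k ^ 2 + k)%N
  / ((1 - Z' * x) ^+ k.+1 * (1 - x ^+ 2) ^+ 'C(k.+1, 2)
     * (1 - x ^+ 2 * Y' ^+ 2) ^+ 'C(k.+1, 2)).
Proof.
pose c := @lift_x R.
have cD : {morph c : a b / a + b} by apply: rmorphD.
have cN : {morph c : a / - a} by apply: rmorphN.
have cM : {morph c : a b / a * b} by apply: rmorphM.
have cX m : {morph c : a / a ^+ m} by apply: rmorphXn.
have cV : {morph c : a / a^-1} by apply: lift_xV.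
have c1 : c 1 = 1 by apply: rmorph1.
rewrite /product_form -/c !cM !cV !cM !cX !cD !cN !cM !c1.
by rewrite /c lift_x_var !lift_x_const.
Qed.

(** The double count: both sides are the weighted number of pairs formed by an
    involution and a compatible word in the letters 0, ..., 2k. *)
Lemma involution_seriesE n k :
  fpscoef (involution_series n.+1) k = fpscoef (product_form y z k) n.+1.
Proof.
rewrite -prod_block_series -sum_labelled_wt_series /involution_series.
rewrite mulr_sumr fpscoef_sum; apply: eq_bigr => s _.
rewrite -mulr_sumr -(eq_bigl _ _ (chain_compatible s)) -fpscoef_chain_series //.
by rewrite -fpscoef_constM rmorphXn !mulrA; congr (fpscoef _ k); rewrite [LHS]mulrC !mulrA.
Qed.

Lemma product_form0 k : fpscoef (product_form y z k) 0 = 1.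
Proof.
have coef0M (f g : {fps R}) : fpscoef (f * g) 0 = fpscoef f 0 * fpscoef g 0.
  by rewrite fpscoefM big_ord1.
rewrite -prod_block_series (big_morph (fun f => fpscoef f 0) coef0M (erefl _)).
rewrite big1 // => p _ /=; rewrite /block_coef /= implybT if_same !expr0 mulr1.
by rewrite !if_same.
Qed.

Lemma inv_1Bvar k : fpscoef ((1 - t)^-1) k = 1.
Proof.
have U1t : 1 - t \is a GRing.unit by rewrite fps_unitE fpscoefB subr0 unitr1.
have -> : (1 - t)^-1 = FPS (fun=> 1); last by [].
apply: (mulrI U1t); rewrite mulrV //; apply: fpsP => -[|n].
  by rewrite fpscoef_1BvarM subr0.
by rewrite fpscoef_1BvarM subrr.
Qed.

(** The summand (1-t)^-1 is the coefficient of x^0, as each term of the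
    right-hand side has constant coefficient t^k in x. *)
Lemma involution_identity :
  (1 - fps_const t)^-1
  + FPS (fun n => if n is 0%N then 0 else involution_series n) =
  FPS (fun n => FPS (fun k => fpscoef (product_form y z k) n)).
Proof.
have -> : (1 - fps_const t)^-1 = fps_const ((1 - t)^-1).
  by rewrite fps_constV rmorphB rmorph1.
apply: fpsP => -[|n]; apply: fpsP => k; rewrite fpscoefD.
  rewrite -[LHS]/(fpscoef ((1 - t)^-1) k + 0) addr0 inv_1Bvar.
  by rewrite -[RHS]/(fpscoef (product_form y z k) 0) product_form0.
rewrite -[LHS]/(0 + fpscoef (involution_series n.+1) k) add0r.
exact: involution_seriesE.
Qed.

End Identity.

Theorem theorem5p12 :
  let x := xvar in let t := tvar in let y := yvar in let z := zvar in
  exists A B : {fps {fps Qyz}},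
  [/\ fps_sum_to
        (fun m => let n := m.+1 in
           (1 + y * t) ^+ n / (1 - t) ^+ n.+1
           * I_lpk_des_fix n
               ((1 + y) ^+ 2 * t / ((y + t) * (1 + y * t)))
               ((y + t) / (1 + y * t))
               z
           * x ^+ n) A,
      fps_sum_to
        (fun k =>
           (1 + z * x * y) ^+ k * (1 + x ^+ 2 * y) ^+ (k ^ 2 + k)%N * t ^+ k
           / ((1 - z * x) ^+ k.+1
              * (1 - x ^+ 2) ^+ 'C(k.+1, 2)
              * (1 - x ^+ 2 * y ^+ 2) ^+ 'C(k.+1, 2))) B
    & (1 - t)^-1 + A = B].
Proof.
move=> x t y z.
pose y0 : Qyz := FracField.tofrac 'X%:P.
pose z0 : Qyz := FracField.tofrac 'X.
have Uy0 : y0 \is a GRing.unit.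
  by rewrite unitfE tofrac_eq0 polyC_eq0 polyX_eq0.
exists (FPS (fun n => if n is 0 then 0 else involution_series y0 z0 n)).
exists (FPS (fun n => FPS (fun k => fpscoef (product_form y0 z0 k) n))).
split.
- by apply: fps_sum_to_powers_x => m; rewrite const_involution_series.
- by apply: fps_sum_to_powers_t => k; rewrite lift_product_form mulrAC.
- exact: involution_identity.
Qed.
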